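(* (1) Let $\mathcal{Q}=(E^0,E^1,r,s,\lambda)$ be a topological quiver, $G$ a locally compact group and $\kappa:E^1\to G$ a cocycle. Then the skew product quiver $\mathcal{Q}\times_\kappa G$ carries a free and proper (right) action of $G$ by right translation in the second coordinate, $(x,h)\cdot g=(x,hg)$ on both vertices and edges, and the quiver of orbits is isomorphic to $\mathcal{Q}$. (2) Conversely, let $\mathcal{R}=(F^0,F^1,r,s,\lambda)$ be a topological quiver with a free and proper action of a locally compact group $G$. If the vertex orbit map $q:F^0\to q(F^0)$ is trivial (so that $F^0\cong q(F^0)\times G$), then $\mathcal{R}$ is isomorphic to a skew product quiver.
   Context: A topological quiver $(E^0,E^1,r,s,\lambda)$ consists of locally compact Hausdorff spaces $E^0$ (vertices) and $E^1$ (edges), continuous maps $r,s:E^1\to E^0$ with $s$ open, and a full $s$-system $\lambda=\{\lambda_v\}_{v\in E^0}$: positive Radon measures on $E^1$ with $\operatorname{supp}\lambda_v=s^{-1}(v)$ and $v\mapsto\int f\,d\lambda_v$ continuous for every $f\in C_c(E^1)$. By convention systems are also proper: $\lambda_v\ne0$ for all $v$. A cocycle is a continuous map $\kappa:E^1\to G$. The skew product quiver $\mathcal{Q}\times_\kappa G$ has vertex space $E^0\times G$, edge space $E^1\times G$, range map $r_\kappa(e,g)=(r(e),\kappa(e)g)$, source map $s_\kappa(e,g)=(s(e),g)$ and measures $\lambda_{v,g}(U)=\lambda_v(\{e:(e,g)\in U\})$. A quiver morphism is a pair of continuous maps $(\phi^0,\phi^1)$ of vertex and edge spaces with $r\circ\phi^1=\phi^0\circ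 r$ and $s\circ\phi^1=\phi^0\circ s$. An isomorphism of quivers is a morphism with $\phi^0,\phi^1$ homeomorphisms and $\lambda_v(U)=\mu_{\phi^0(v)}(\phi^1(U))$ for every vertex $v$ and measurable $U\subseteq s^{-1}(v)$, where $\lambda,\mu$ are the systems of domain and codomain. An action of $G$ on a quiver is a continuous (right) action by quiver automorphisms (continuous actions on vertices and edges for which $r,s$ are equivariant and the system of measures is preserved). It is free (proper) if the action on the vertex space is free (respectively, the map $(v,g)\mapsto(v,vg)$ is proper); it is then free (proper) on edges. For a free and proper action, the quiver of orbits has as vertex and edge spaces the orbit spaces $q(E^0)$, $q(E^1)$ ($q$ denotes orbit maps), induced range and source maps $\dot r,\dot s$, and measures $\dot\lambda_{q(v)}$ equal to the push-forward of $\lambda_v$ under $q:s^{-1}(v)\to\dot s^{-1}(q(v))$ (a homeomorphism). Triviality of $q:F^0\to q(F^0)$ means there is a $G$-equivariant homeomorphism $F^0\cong q(F^0)\times G$ over $q(F^0)$, with $G$ acting by right translation on the second factor. *)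

(* Defs.v *)
From HB Require Import structures.
From mathcomp Require Import all_boot all_order all_algebra.
From mathcomp Require Import all_classical all_reals all_analysis.

Set Implicit Arguments.
Unset Strict Implicit.
Unset Printing Implicit Defensive.

Import Order.TTheory GRing.Theory Num.Theory.
Import numFieldNormedType.Exports.

Local Open Scope classical_set_scope.
Local Open Scope ring_scope.
Local Open Scope quotient_scope.

HB.mixin Record Group_isTopologicalGroup G of Group G & Topological G := {
  mulg_continuous : continuous (fun xy : G * G => (xy.1 * xy.2)%g) ;
  invg_continuous : continuous (fun x : G => (x^-1)%g)
}.

#[short(type="topologicalGroupType")]
HB.structure Definition TopologicalGroup :=
  {G of Group G & Topological G & Group_isTopologicalGroup G}.

(* Also used for the group: locally compact groups are Hausdorff by convention. *)
Definition locally_compact_hausdorff (X : topologicalType) : Prop :=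
  locally_compact [set: X] /\ hausdorff_space X.

Definition open_map (X Y : topologicalType) (f : X -> Y) : Prop :=
  forall U, open U -> open (f @` U).

Definition homeomorphism (X Y : topologicalType) (f : X -> Y) : Prop :=
  continuous f /\
  exists g : Y -> X, [/\ continuous g, cancel f g & cancel g f].

Definition proper_map (X Y : topologicalType) (f : X -> Y) : Prop :=
  continuous f /\ forall K, compact K -> compact (f @^-1` K).

(* C_c(X), with real values; the condition on integrals in [full_system] for
   complex-valued functions is the conjunction of those for their real and
   imaginary parts. *)
Definition compactly_supported (R : realType) (X : topologicalType)
    (f : X -> R) : Prop :=
  continuous f /\ compact (closure [set x | f x != 0]).

Definition pointed_at (X : topologicalType) (x : X) : Type := X.
HB.instance Definition _ (X : topologicalType) (x : X) :=
  Choice.on (pointed_at x).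
HB.instance Definition _ (X : topologicalType) (x : X) :=
  isPointed.Build (pointed_at x) x.

Definition borel (X : topologicalType) (x : X) :=
  g_sigma_algebraType (@open X : set (set (pointed_at x))).

(* The measurable types of the library are pointed.  The point is carried by the
   measure and not by the space, so that empty spaces are allowed; a space with a
   nonzero measure (the only ones that occur in a proper system) is nonempty, and
   neither the sigma-algebra nor the notions below depend on the point. *)
Record borel_measure (R : realType) (X : topologicalType) := BorelMeasure {
  base : X ;
  measure_of :> {measure set (borel base) -> \bar R}
}.

Definition borel_set (X : topologicalType) : set (set X) := <<s @open X >>.

Section borel_pushforward.
Context (R : realType) (X Y : topologicalType) (f : X -> Y).
Hypothesis cf : continuous f.

Lemma continuous_borel_measurable (x : X) :
  measurable_fun [set: borel x] (f : borel x -> borel (f x)).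
Proof.
apply: (@measurability _ _ (borel x) (borel (f x)) setT f (@open Y)) => //.
move=> _ [B oB <-]; rewrite setTI; apply: sub_sigma_algebra.
by move/continuousP : cf; exact.
Qed.

Definition borel_pushforward (mu : borel_measure R X) : borel_measure R Y :=
  BorelMeasure (measure_function_pushforward__canonical__measure_function_Measure
    (measure_of mu) (@continuous_borel_measurable (base mu))).

Lemma borel_pushforwardE (mu : borel_measure R X) (U : set Y) :
  borel_pushforward mu U = mu (f @^-1` U).
Proof. by []. Qed.

End borel_pushforward.

Record radon (R : realType) (X : topologicalType) (mu : borel_measure R X) :
    Prop := {
  radon_compact : forall K : set X, compact K -> (mu K < +oo)%E ;
  radon_outer : forall A : set X, borel_set A ->
    mu A = ereal_inf [set mu U | U in [set U : set X | open U /\ A `<=` U]] ;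
  radon_inner : forall U : set X, open U ->
    mu U = ereal_sup [set mu K | K in [set K : set X | compact K /\ K `<=` U]]
}.

Definition support (R : realType) (X : topologicalType)
    (mu : borel_measure R X) : set X :=
  [set x | forall U : set X, open U -> U x -> (0 < mu U)%E].

Record quiver (R : realType) := Quiver {
  vert : topologicalType ;
  edge : topologicalType ;
  rng : edge -> vert ;
  src : edge -> vert ;
  sys : vert -> borel_measure R edge
}.
Arguments rng {R} _ _.
Arguments src {R} _ _.
Arguments sys {R} _ _.

Record full_system (R : realType) (X Y : topologicalType) (s : Y -> X)
    (lambda : X -> borel_measure R Y) : Prop := {
  system_radon : forall v, radon (lambda v) ;
  system_support : forall v, support (lambda v) = s @^-1` [set v] ;
  system_continuous : forall f : Y -> R, compactly_supported f ->
    continuous (fun v => \int[lambda v]_(e in setT) f e) ;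
  system_proper : forall v, lambda v setT != 0%E
}.

Record topological_quiver (R : realType) (Q : quiver R) : Prop := {
  vert_lch : locally_compact_hausdorff (vert Q) ;
  edge_lch : locally_compact_hausdorff (edge Q) ;
  rng_continuous : continuous (rng Q) ;
  src_continuous : continuous (src Q) ;
  src_open : open_map (src Q) ;
  sys_full : full_system (src Q) (sys Q)
}.

Record quiver_morphism (R : realType) (Q P : quiver R)
    (phi0 : vert Q -> vert P) (phi1 : edge Q -> edge P) : Prop := {
  morph_vert_continuous : continuous phi0 ;
  morph_edge_continuous : continuous phi1 ;
  morph_rng : forall e, rng P (phi1 e) = phi0 (rng Q e) ;
  morph_src : forall e, src P (phi1 e) = phi0 (src Q e)
}.

Record quiver_isomorphism (R : realType) (Q P : quiver R)
    (phi0 : vert Q -> vert P) (phi1 : edge Q -> edge P) : Prop := {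
  iso_morphism : quiver_morphism phi0 phi1 ;
  iso_vert_homeo : homeomorphism phi0 ;
  iso_edge_homeo : homeomorphism phi1 ;
  iso_sys : forall (v : vert Q) (U : set (edge Q)), borel_set U ->
    U `<=` src Q @^-1` [set v] -> sys Q v U = sys P (phi0 v) (phi1 @` U)
}.

Definition isomorphic (R : realType) (Q P : quiver R) : Prop :=
  exists (phi0 : vert Q -> vert P) (phi1 : edge Q -> edge P),
    quiver_isomorphism phi0 phi1.

Record right_action (G : groupType) (X : Type) := RightAction {
  ract :> X -> G -> X ;
  ract1 : forall x, ract x 1%g = x ;
  ractM : forall x g h, ract x (g * h)%g = ract (ract x g) h
}.

Section orbit_space.
Context (G : groupType) (X : topologicalType) (a : right_action G X).

Definition orbit_rel : rel X := fun x y => `[< exists g, y = a x g >].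

Lemma orbit_rel_refl : reflexive orbit_rel.
Proof. by move=> x; apply/asboolP; exists 1%g; rewrite ract1. Qed.

Lemma orbit_rel_sym : symmetric orbit_rel.
Proof.
move=> x y; apply/asboolP/asboolP => -[g ->]; exists (g^-1)%g;
  by rewrite -ractM mulgV ract1.
Qed.

Lemma orbit_rel_trans : transitive orbit_rel.
Proof.
move=> y x z /asboolP[g ->] /asboolP[h ->]; apply/asboolP.
by exists (g * h)%g; rewrite ractM.
Qed.

Canonical orbit_equiv :=
  EquivRel orbit_rel orbit_rel_refl orbit_rel_sym orbit_rel_trans.

Definition orbit_space : topologicalType :=
  quotient_topology {eq_quot orbit_equiv}.

Definition orbit_map (x : X) : orbit_space :=
  \pi_(quotient_topology {eq_quot orbit_equiv}) x.

Definition orbit_repr (o : orbit_space) : X :=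
  repr (o : quotient_topology {eq_quot orbit_equiv}).

Lemma orbit_map_continuous : continuous orbit_map.
Proof. exact: pi_continuous. Qed.

Lemma orbit_reprK : cancel orbit_repr orbit_map.
Proof. exact: reprK. Qed.

Lemma orbit_mapP (x y : X) : orbit_map x = orbit_map y <-> exists g, y = a x g.
Proof. by split=> [/eqmodP /asboolP | h] //; apply/eqmodP/asboolP. Qed.

End orbit_space.

Section action_properties.
Context (G : topologicalGroupType) (X : topologicalType) (a : right_action G X).

Definition continuous_action : Prop :=
  continuous (fun xg : X * G => a xg.1 xg.2).

Definition free_action : Prop := forall x g, a x g = x -> g = 1%g.

Definition proper_action : Prop :=
  proper_map (fun xg : X * G => (xg.1, a xg.1 xg.2)).

Definition trivial_orbit_map : Prop :=
  exists phi : X -> orbit_space a * G,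
    [/\ homeomorphism phi,
        forall x, (phi x).1 = orbit_map a x
      & forall x g, phi (a x g) = ((phi x).1, ((phi x).2 * g)%g)].

End action_properties.

Section quiver_action.
Context (R : realType) (G : topologicalGroupType) (Q : quiver R).
Variables (a0 : right_action G (vert Q)) (a1 : right_action G (edge Q)).

Record quiver_action : Prop := {
  action_vert_continuous : continuous_action a0 ;
  action_edge_continuous : continuous_action a1 ;
  action_automorphism : forall g,
    @quiver_isomorphism R Q Q (fun v => a0 v g) (fun e => a1 e g)
}.

Definition free_quiver_action : Prop := free_action a0.

Definition proper_quiver_action : Prop := proper_action a0.

(* Range, source and measures are evaluated at a representative of the orbit;
   when (a0, a1) is a quiver action the choice does not matter, by equivariance
   and invariance.  Since lambda_v is concentrated on its support, the fibre
   s^-1(v), its push-forward under the restriction of the orbit map to s^-1(v)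
   is its push-forward under the orbit map. *)
Definition orbit_quiver : quiver R := {|
  vert := orbit_space a0 ;
  edge := orbit_space a1 ;
  rng := fun o => orbit_map a0 (rng Q (orbit_repr o)) ;
  src := fun o => orbit_map a0 (src Q (orbit_repr o)) ;
  sys := fun o =>
    borel_pushforward (@orbit_map_continuous G (edge Q) a1)
      (sys Q (orbit_repr o))
|}.

End quiver_action.

Section skew_product.
Context (R : realType) (G : topologicalGroupType) (Q : quiver R).
Variable kappa : edge Q -> G.

Lemma pair_continuous (g : G) : continuous (fun e : edge Q => (e, g)).
Proof. by move=> e; apply: cvg_pair; [exact: cvg_id | exact: cvg_cst]. Qed.

(* borel_pushforward (pair_continuous g) mu U = mu [set e | U (e, g)] *)
Definition skew_product : quiver R := {|
  vert := (vert Q * G)%type ;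
  edge := (edge Q * G)%type ;
  rng := fun eg => (rng Q eg.1, (kappa eg.1 * eg.2)%g) ;
  src := fun eg => (src Q eg.1, eg.2) ;
  sys := fun vg => borel_pushforward (@pair_continuous vg.2) (sys Q vg.1)
|}.

End skew_product.

Section right_translation.
Context (G : groupType) (X : Type).

Let translate (xh : X * G) (g : G) : X * G := (xh.1, (xh.2 * g)%g).

Let translate1 xh : translate xh 1%g = xh.
Proof. by case: xh => x h; rewrite /translate /= mulg1. Qed.

Let translateM xh g h :
  translate xh (g * h)%g = translate (translate xh g) h.
Proof. by rewrite /translate /= mulgA. Qed.

Definition right_translation : right_action G (X * G) :=
  RightAction translate1 translateM.

End right_translation.

(* Main.v *)
(* A continuous equivariant map c : vert F -> G yields, on vertices and (through
   s) on edges, continuous sections x G |-> x c(x)^-1 of the orbit maps onto the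
   slice {c = 1}.  They make F equivariantly the product of its orbit quiver
   with G, and F is the skew product by kappa(e G) = c(r(e)) c(s(e))^-1.  The
   measures are transported along maps having a continuous left inverse off a
   null set: this covers both the inclusions e |-> (e, g) of a skew product and
   the orbit map on a fibre of s.  Continuity of the integrals over an orbit
   quiver is obtained by cutting the pull-back of a function in C_c off with a
   bump function at 1 in G.  Part (1) uses c = snd, part (2) the second
   component of the given trivialization. *)
Require Import Defs.
From mathcomp Require Import all_boot all_order all_algebra.
From mathcomp Require Import all_classical all_reals all_analysis.
From mathcomp Require Import measurable_realfun.

Set Implicit Arguments.
Unset Strict Implicit.
Unset Printing Implicit Defensive.

Import Order.TTheory GRing.Theory Num.Theory.
Import numFieldNormedType.Exports.

Local Open Scope classical_set_scope.
Local Open Scope ring_scope.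

(** * Locally compact Hausdorff spaces *)

(** Compactness as an induction principle. If [P K] failed, the sets [A] with [P (K \ A)] would form
    a proper filter containing [K]; at a cluster point [p], a neighbourhood [U] with [P U] would
    have its complement in that filter, which is absurd. *)
Lemma compact_set_ind (X : topologicalType) (P : set X -> Prop) (K : set X) :
  P set0 -> (forall A B, P A -> P B -> P (A `|` B)) ->
  (forall A B, A `<=` B -> P B -> P A) ->
  compact K -> (forall x, K x -> exists2 U, nbhs x U & P U) -> P K.
Proof.
move=> P0 PU Psub cK Kloc; apply: contrapT => nPK.
pose F : set_system X := [set A | P (K `\` A)].
have FF : ProperFilter F.
  split; first by rewrite /F /= setD0.
  split=> [|A B|A B AB]; rewrite /F /=; first by rewrite setDT.
    by move=> FA FB; rewrite setDIr; exact: PU.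
  by apply: Psub; exact: setDS.
have FK : F K by rewrite /F /= setDv.
have [p [Kp clp]] := cK F FF FK.
have [U pU PU'] := Kloc p Kp.
have /clp/(_ pU)[y []//] : F (~` U).
by apply: Psub PU' => y [_ /contrapT].
Qed.

Lemma locally_compactP (X : topologicalType) :
  locally_compact [set: X] <->
  forall x : X, exists U, [/\ nbhs x U, compact U & closed U].
Proof.
split=> lcX x => [|_].
  have [U xU [cU clU]] := lcX x I.
  exists U; split=> //; move: xU; rewrite /within /=.
  by apply: filterS => y; exact.
have [U [xU cU clU]] := lcX x; exists U => //.
by rewrite /within /=; apply: filterS xU.
Qed.

Lemma hausdorff_injective (X Y : topologicalType) (f : X -> Y) :
  continuous f -> injective f -> hausdorff_space Y -> hausdorff_space X.
Proof.
move=> cf injf hY x y clxy; apply: injf; apply: hY => A B fxA fyB.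
have [z [Az Bz]] := clxy _ _ (cf x _ fxA) (cf y _ fyB).
by exists (f z).
Qed.

Lemma continuous_fst (X Y : topologicalType) : continuous (@fst X Y).
Proof. by move=> p; exact: cvg_fst. Qed.

Lemma continuous_snd (X Y : topologicalType) : continuous (@snd X Y).
Proof. by move=> p; exact: cvg_snd. Qed.

Lemma continuous_pair (X Y Z : topologicalType) (f : X -> Y) (g : X -> Z) :
  continuous f -> continuous g -> continuous (fun x => (f x, g x)).
Proof. by move=> cf cg x; apply: cvg_pair; [exact: cf | exact: cg]. Qed.

Lemma comp_continuous (X Y Z : topologicalType) (f : X -> Y) (g : Y -> Z) :
  continuous f -> continuous g -> continuous (fun x => g (f x)).
Proof. by move=> cf cg x; apply: continuous_comp; [exact: cf | exact: cg]. Qed.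

Lemma hausdorff_prod (X Y : topologicalType) :
  hausdorff_space X -> hausdorff_space Y -> hausdorff_space (X * Y)%type.
Proof.
move=> hX hY [x y] [x' y'] cl; congr pair.
  apply: hX => A B xA xB.
  have [z [Az Bz]] := cl (fst @^-1` A) (fst @^-1` B)
    (@continuous_fst X Y (x, y) A xA) (@continuous_fst X Y (x', y') B xB).
  by exists z.1.
apply: hY => A B xA xB.
have [z [Az Bz]] := cl (snd @^-1` A) (snd @^-1` B)
  (@continuous_snd X Y (x, y) A xA) (@continuous_snd X Y (x', y') B xB).
by exists z.2.
Qed.

Lemma closed_equalizer (X Y : topologicalType) (f g : X -> Y) :
  hausdorff_space Y -> continuous f -> continuous g ->
  closed [set x | f x = g x].
Proof.
move=> hY cf cg x clx; apply: hY => A B fxA gxB.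
have [z [/= fgz [Az Bz]]] :
    [set x | f x = g x] `&` (f @^-1` A `&` g @^-1` B) !=set0.
  by apply: clx; apply: filterI; [exact: cf | exact: cg].
by exists (f z); split=> //; rewrite fgz.
Qed.

Lemma lch_prod (X Y : topologicalType) :
  locally_compact_hausdorff X -> locally_compact_hausdorff Y ->
  locally_compact_hausdorff (X * Y)%type.
Proof.
move=> [lX hX] [lY hY]; split; last exact: hausdorff_prod.
apply/locally_compactP => -[x y].
have [U [xU cU _]] := (locally_compactP X).1 lX x.
have [V [yV cV _]] := (locally_compactP Y).1 lY y.
have cUV := compact_setX cU cV.
exists (U `*` V); split=> //; first by exists (U, V).
by apply: compact_closed => //; exact: hausdorff_prod.
Qed.

Lemma image_compact (X Y : topologicalType) (f : X -> Y) (K : set X) :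
  continuous f -> compact K -> compact (f @` K).
Proof.
by move=> cf; apply: continuous_compact; exact: continuous_subspaceT.
Qed.

Lemma open_map_nbhs (X Y : topologicalType) (f : X -> Y) :
  open_map f -> forall x U, nbhs x U -> nbhs (f x) (f @` U).
Proof.
move=> of_ x U; rewrite nbhsE => -[V [oV Vx] VU].
rewrite nbhsE; exists (f @` V); last exact: image_subset.
by split; [exact: of_ | exists x].
Qed.

Lemma open_map_prod_id (X Y Z : topologicalType) (f : X -> Y) :
  open_map f -> open_map (fun xz : X * Z => (f xz.1, xz.2)).
Proof.
move=> of_ W; rewrite openE => oW; rewrite openE => _ [[x z] Wxz <-].
have [[U V] /= [xU zV] UVW] := oW _ Wxz.
exists (f @` U, V); first by split => //=; exact: open_map_nbhs.
by move=> [_ z'] /= [[x' Ux' <-] Vz']; exists (x', z') => //; exact: UVW.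
Qed.

(** A continuous open map sends compact neighbourhoods to compact neighbourhoods, which are closed
    because the target is Hausdorff. This is meant for orbit maps. *)
Lemma locally_compact_open_image (X Y : topologicalType) (f : X -> Y) :
  continuous f -> open_map f -> set_surj setT setT f ->
  hausdorff_space Y -> locally_compact [set: X] -> locally_compact [set: Y].
Proof.
move=> cf of_ sf hY /locally_compactP lX; apply/locally_compactP => y.
have [x _ <-] := sf y I; have [U [xU cU _]] := lX x.
have cfU := image_compact cf cU.
by exists (f @` U); split => //; [exact: open_map_nbhs | exact: compact_closed].
Qed.

(** Complete regularity separates [x] from the complement of the interior of a compact neighbourhood
    [U] by some [f]; then [1 - f] vanishes off [U]. *)
Lemma point_bump (R : realType) (X : topologicalType) (x : X) :
  locally_compact_hausdorff X ->
  exists chi : X -> R, [/\ compactly_supported chi, forall y, 0 <= chi y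
    & chi x = 1].
Proof.
move=> [lX hX]; have [U [xU cU clU]] := (locally_compactP X).1 lX x.
have cUi : closed (~` U°) by apply: open_closedC; exact: open_interior.
have nUi : ~ (~` U°) x by move=> /(_ xU).
have sep := @locally_compact_completely_regular X R lX hX x (~` U°) cUi nUi.
have [f [cf f01 fx fU]] := (@uniform_separatorP X R _ _).1 sep.
have f0y y : 0 <= f y <= 1.
  by have /= := f01 (f y); rewrite in_itv /=; apply; exists y.
exists (fun y => 1 - f y); split => [|y|]; last first.
- by have /= -> := fx (f x) (ex_intro2 _ _ x erefl erefl); rewrite subr0.
- by rewrite subr_ge0; have /andP[] := f0y y.
split; first by move=> y; apply: cvgB; [exact: cvg_cst | exact: cf].
apply: (subclosed_compact _ cU); first exact: closed_closure.
rewrite [X in _ `<=` X](closure_id U).1//; apply: closureS => y /= fy.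
apply: interior_subset; apply: contrapT => nUy.
by move/eqP: fy; apply; have /= -> := fU (f y) (ex_intro2 _ _ y nUy erefl);
  rewrite subrr.
Qed.

Lemma compactly_supported0 (R : realType) (X : topologicalType) :
  compactly_supported (fun _ : X => 0 : R).
Proof.
split; first by move=> x; exact: cvg_cst.
rewrite (_ : [set _ | _] = set0) ?closure0; first exact: compact0.
by apply/seteqP; split => // x /=; rewrite eqxx.
Qed.

Lemma compactly_supportedP (R : realType) (X : topologicalType) (f : X -> R) :
  hausdorff_space X -> continuous f ->
  compactly_supported f <-> exists2 K, compact K & forall x, ~ K x -> f x = 0.
Proof.
move=> hX cf; split=> [[_ cK]|[K cK Kf]].
  exists (closure [set x | f x != 0]) => // x nx; apply/eqP.
  by apply: contrapT => /negP fx; apply: nx; exact: subset_closure.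
split=> //; apply: (subclosed_compact _ cK); first exact: closed_closure.
rewrite [X in _ `<=` X](closure_id K).1; last exact: compact_closed.
by apply: closureS => x /= fx; apply: contrapT => /Kf/eqP; rewrite (negbTE fx).
Qed.

(** The bound [1 <= chi] on [K], rather than an equality, survives adding two such functions, so
    induction on compact sets reduces the claim to a neighbourhood of one point. *)
Lemma compact_bump (R : realType) (X : topologicalType) (K : set X) :
  locally_compact_hausdorff X -> compact K ->
  exists chi : X -> R, [/\ compactly_supported chi, forall y, 0 <= chi y
    & forall x, K x -> 1 <= chi x].
Proof.
move=> lchX cK; have hX := lchX.2.
pose P A := exists chi : X -> R, [/\ compactly_supported chi,
  forall y, 0 <= chi y & forall x, A x -> 1 <= chi x].
suff: P K by []; apply: compact_set_ind cK _.
- by exists (fun=> 0); split => //; exact: compactly_supported0.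
- move=> A B [f [cf f0 fA]] [g [cg g0 gB]]; exists (fun x => f x + g x); split.
  + have [K1 cK1 Kf] := (compactly_supportedP hX cf.1).1 cf.
    have [K2 cK2 Kg] := (compactly_supportedP hX cg.1).1 cg.
    apply/compactly_supportedP => //.
      by move=> x; apply: cvgD; [exact: cf.1|exact: cg.1].
    exists (K1 `|` K2); first exact: compactU.
    by move=> x /not_orP[n1 n2]; rewrite Kf// Kg// addr0.
  + by move=> y; rewrite addr_ge0.
  + move=> x [/fA|/gB] h; first by rewrite ler_wpDr.
    by rewrite ler_wpDl.
- by move=> A B AB [f [cf f0 fB]]; exists f; split => // x /AB/fB.
- move=> x _; have [f [cf f0 fx]] := point_bump R x lchX.
  (* A point bump equals 1 only at [x], but its double is at least 1 on this whole neighbourhood. *)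
  exists [set y | 1 / 2 < f y].
    apply: (cf.1 x [set z : R | 1 / 2 < z]); apply: open_nbhs_nbhs.
    split; first exact: open_gt.
    by rewrite /= fx ltr_pdivrMr// mul1r ltr1n.
  exists (fun y => 2 * f y); split.
  + have [L cL Lf] := (compactly_supportedP hX cf.1).1 cf.
    apply/compactly_supportedP => //.
      by move=> y; apply: cvgM; [exact: cvg_cst | exact: cf.1].
    by exists L => // y /Lf ->; rewrite mulr0.
  + by move=> y; rewrite mulr_ge0.
  + by move=> y /= /ltW; rewrite ler_pdivrMr// mulrC.
Qed.

(** * Borel measures *)

Lemma open_borel (X : topologicalType) (U : set X) : open U -> borel_set U.
Proof. exact: sub_sigma_algebra. Qed.

Lemma closed_borel (X : topologicalType) (C : set X) : closed C -> borel_set C.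
Proof.
move=> cC; have [_ + _] := smallest_sigma_algebra setT (@open X).
by move=> /(_ _ (open_borel (closed_openC cC))); rewrite setTD setCK.
Qed.

Lemma borelC (X : topologicalType) (A : set X) :
  borel_set A -> borel_set (~` A).
Proof.
have [_ + _] := smallest_sigma_algebra setT (@open X).
by move=> /[apply]; rewrite setTD.
Qed.

Lemma borelI (X : topologicalType) (A B : set X) :
  borel_set A -> borel_set B -> borel_set (A `&` B).
Proof.
(* The type [borel x] requires a point, which any nonempty intersection supplies; the empty set is
   handled as a closed set. *)
move=> mA mB; have [->|/set0P[x _]] := eqVneq (A `&` B) set0.
  exact: closed_borel closed0.
exact: (@measurableI _ (borel x)).
Qed.

Lemma preimage_borel (X Y : topologicalType) (f : X -> Y) (A : set Y) :
  continuous f -> borel_set A -> borel_set (f @^-1` A).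
Proof.
move=> cf mA; have [->|/set0P[x _]] := eqVneq (f @^-1` A) set0.
  exact: closed_borel closed0.
rewrite -[_ @^-1` _]setTI.
exact: (@continuous_borel_measurable _ _ f cf x measurableT).
Qed.

Lemma continuous_measurable (R : realType) (X : topologicalType) (x : X)
    (f : X -> R) :
  continuous f -> measurable_fun [set: borel x] (f : borel x -> R).
Proof.
move=> cf; apply: (measurability _ (RGenOpens.measurableE R)).
move=> _ [_ [a [b ->] <-]]; rewrite setTI; apply: sub_sigma_algebra.
by move/continuousP : cf; apply; exact: interval_open.
Qed.

Section borel_measure_theory.
Context (R : realType) (X : topologicalType) (mu : borel_measure R X).
Local Open Scope ereal_scope.
Implicit Types A B : set X.

Lemma le_borel_measure A B :
  borel_set A -> borel_set B -> A `<=` B -> mu A <= mu B.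
Proof.
by move=> mA mB; apply: (@le_measure _ _ _ (measure_of mu)); rewrite inE.
Qed.

Lemma le_borel_measure_mod A B C : borel_set A -> borel_set B -> borel_set C ->
  mu (~` C) = 0 -> A `&` C `<=` B -> mu A <= mu B.
Proof.
move=> mA mB mC C0 AB; have mC' := borelC mC.
rewrite -(@measureU0 _ (borel (base mu)) _ mu _ _ mB mC' C0).
apply: le_borel_measure => //; first exact: (@measurableU _ (borel (base mu))).
by move=> x Ax; have [Cx|nCx] := pselect (C x); [left; apply: AB | right].
Qed.

Lemma eq_borel_measure_mod A B C : borel_set A -> borel_set B -> borel_set C ->
  mu (~` C) = 0 -> A `&` C = B `&` C -> mu A = mu B.
Proof.
move=> mA mB mC C0 AB; apply/eqP; rewrite eq_le; apply/andP; split.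
  by apply: (@le_borel_measure_mod A B C) => //; rewrite AB; exact: subIsetl.
by apply: (@le_borel_measure_mod B A C) => //; rewrite -AB; exact: subIsetl.
Qed.

(** Points outside the support have null open neighbourhoods. Inner regularity reduces the claim to
    compact subsets of the complement of [C], and finitely many such neighbourhoods cover each of
    these. *)
Lemma radon_support_null C : hausdorff_space X -> radon mu -> closed C ->
  Defs.support mu `<=` C -> mu (~` C) = 0.
Proof.
move=> hX rmu cC sC; rewrite (radon_inner rmu (closed_openC cC)).
apply/eqP; rewrite eq_le; apply/andP; split; last first.
  apply: ereal_sup_ubound; exists set0; rewrite ?measure0//.
  by split => //; exact: compact0.
apply: ge_ereal_sup => _ [K [cK KC] <-].
(* Asking for a null open superset, rather than for [mu A = 0], makes [P] pass to arbitrary subsets,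
   Borel or not. *)
pose P A := exists V, [/\ open V, A `<=` V & mu V = 0].
suff [V [oV KV V0]] : P K.
  rewrite -V0; apply: le_borel_measure => //; last exact: open_borel.
  by apply: closed_borel; exact: compact_closed.
apply: compact_set_ind cK _.
- by exists set0; split; rewrite ?measure0//; exact: open0.
- move=> A B [V [oV AV V0]] [W [oW BW W0]]; exists (V `|` W); split.
  + exact: openU.
  + exact: setUSS.
  + rewrite (@measureU0 _ (borel (base mu)))//; exact: open_borel.
- move=> A B AB [V [oV BV V0]]; exists V.
  by split => //; exact: subset_trans BV.
- move=> x /KC nCx; have /existsNP[U] : ~ Defs.support mu x by move=> /sC.
  move=> /not_implyP[oU] /not_implyP[Ux] /negP.
  rewrite -leNgt measure_le0 => /eqP U0.
  by exists U; [exact: open_nbhs_nbhs | exists U; split].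
Qed.

End borel_measure_theory.

Lemma integral_borel_change (R : realType) (X Y : topologicalType)
    (mu : borel_measure R X) (nu : borel_measure R Y) (h : X -> Y)
    (f : Y -> R) :
  continuous h -> continuous f ->
  (forall U, borel_set U -> nu U = mu (h @^-1` U)) ->
  \int[nu]_(y in setT) f y = \int[mu]_(x in setT) f (h x).
Proof.
move=> ch cf munu.
have mh : measurable_fun [set: borel (base mu)] (h : _ -> borel (base nu)).
  by move=> _ A mA; rewrite setTI; exact: preimage_borel.
have mf : measurable_fun [set: borel (base nu)] (EFin \o f).
  by apply/measurable_EFinP; exact: continuous_measurable.
have int g : (forall y, 0 <= g y)%E ->
    measurable_fun [set: borel (base nu)] g ->
    (\int[nu]_(y in setT) g y = \int[mu]_(x in setT) g (h x))%E.
  move=> g0 mg.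
  pose muh := @pushforward _ _ (borel (base mu)) (borel (base nu)) _ mu h.
  transitivity (\int[muh]_(y in setT) g y)%E.
    by apply: eq_measure_integral => A mA _; rewrite munu.
  by rewrite (ge0_integral_pushforward mh)// => y _; exact: g0.
(* The formula for nonnegative functions is applied to the positive and the negative part
   separately. *)
rewrite /Rintegral integralE [in RHS]integralE; congr (fine (_ - _)%E).
  have E := int _ (funepos_ge0 _) (measurable_funepos mf).
  by refine (etrans E _); apply: eq_integral => x _; rewrite !funeposE.
have E := int _ (funeneg_ge0 _) (measurable_funeneg mf).
by refine (etrans E _); apply: eq_integral => x _; rewrite !funenegE.
Qed.

(** * Push-forward of Radon measures along maps with a continuous left inverse off a null set *)

Section pushforward.
Context (R : realType) (X Y : topologicalType) (f : X -> Y) (s : Y -> X).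
Hypotheses (hX : hausdorff_space X) (hY : hausdorff_space Y).
Hypotheses (cf : continuous f) (cs : continuous s).
Variable mu : borel_measure R X.
Hypotheses (rmu : radon mu) (mu_fs : mu [set x | s (f x) <> x] = 0%E).

Let nu := borel_pushforward cf mu.
Let C := [set x | s (f x) = x].

Let cfs : continuous (s \o f).
Proof. by move=> x; apply: continuous_comp; [exact: cf | exact: cs]. Qed.

Let csf : continuous (f \o s).
Proof. by move=> x; apply: continuous_comp; [exact: cs | exact: cf]. Qed.

Let clC : closed C.
Proof. by apply: closed_equalizer => // x; exact: cvg_id. Qed.

Let off_open : open [set y | f (s y) <> y].
Proof.
by apply: closed_openC; apply: closed_equalizer => // x; exact: cvg_id.
Qed.

Let mC : borel_set C. Proof. exact: closed_borel. Qed.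

(** On the conull set [C], a point of [f @^-1] K[is the image under]s[of a point of]K[, so compact
    sets pull back, modulo a null set, into compact sets. Inner regularity is carried over by the
    compact images]f @[K]. *)
Lemma radon_pushforward : radon nu.
Proof.
split.
- move=> K cK; have csK := image_compact cs cK.
  apply: le_lt_trans (radon_compact rmu csK).
  apply: (le_borel_measure_mod _ _ mC mu_fs).
  + by apply: preimage_borel => //; apply: closed_borel; exact: compact_closed.
  + by apply: closed_borel; exact: compact_closed.
  + by move=> x [Kx Cx]; exists (f x).
- move=> A mA; apply/eqP; rewrite eq_le; apply/andP; split.
    apply: le_ereal_inf_tmp => _ [U [oU AU] <-].
    by apply: le_borel_measure => //; exact: open_borel.
  rewrite /nu borel_pushforwardE (radon_outer rmu); last exact: preimage_borel.
  apply: le_ereal_inf_tmp => _ [V [oV AV] <-].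
  (* s^-1(V) contains A only over the range of f; the second set is open and its
     preimage under f is null. *)
  pose W := s @^-1` V `|` [set y | f (s y) <> y].
  have oW : open W by apply: openU => //; exact: open_comp.
  apply: (@le_trans _ _ (nu W)).
    apply: ereal_inf_lbound; exists W => //; split=> // y Ay.
    have [fsy|] := pselect (f (s y) = y); last by right.
    by left; apply: AV; rewrite /= fsy.
  apply: (le_borel_measure_mod _ _ mC mu_fs).
  + by apply: preimage_borel => //; exact: open_borel.
  + exact: open_borel.
  + by move=> x [Wx Cx]; case: Wx => /=; rewrite [s (f x)]Cx.
- move=> U oU; apply/eqP; rewrite eq_le; apply/andP; split; last first.
    apply: ge_ereal_sup => _ [K [cK KU] <-].
    apply: le_borel_measure => //; last exact: open_borel.
    by apply: closed_borel; exact: compact_closed.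
  rewrite {1}/nu borel_pushforwardE (radon_inner rmu); last exact: open_comp.
  apply: ge_ereal_sup => _ [K [cK KU] <-].
  have cfK := image_compact cf cK.
  apply: (@le_trans _ _ (nu (f @` K))).
    apply: le_borel_measure; [| |by move=> x Kx; exists x].
      by apply: closed_borel; exact: compact_closed.
    by apply: preimage_borel => //; apply: closed_borel; exact: compact_closed.
  apply: ereal_sup_ubound; exists (f @` K) => //.
  by split => // _ [x /KU Ux <-].
Qed.

Lemma support_pushforward : Defs.support nu = f @` Defs.support mu.
Proof.
apply/seteqP; split=> [y Sy|_ [x Sx <-] U oU Ux]; last first.
  by apply: Sx => //; exact: open_comp.
have fsy : f (s y) = y.
  apply: contrapT => nfsy; have := Sy _ off_open nfsy.
  rewrite /nu borel_pushforwardE (_ : mu _ = 0%E) ?ltxx//.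
  apply/eqP; rewrite -measure_le0 -mu_fs; apply: le_borel_measure.
  - by apply: preimage_borel => //; exact: open_borel.
  - exact: borelC.
  - by move=> x /=; apply: contra_not => ->.
exists (s y) => // V oV Vsy.
apply: lt_le_trans (Sy (s @^-1` V) _ Vsy) _; first exact: open_comp.
apply: (le_borel_measure_mod _ _ mC mu_fs).
- by apply: preimage_borel => //; apply: open_borel; exact: open_comp.
- exact: open_borel.
- by move=> x [/= + Cx]; rewrite [s (f x)]Cx.
Qed.

End pushforward.

Lemma compactly_supported_integrable (R : realType) (X : topologicalType)
    (mu : borel_measure R X) (f : X -> R) :
  hausdorff_space X -> radon mu -> compactly_supported f ->
  mu.-integrable [set: borel (base mu)] (EFin \o f).
Proof.
move=> hX rmu csf; have cf := csf.1.
have [K cK Kf] := (compactly_supportedP hX cf).1 csf.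
have mK : borel_set K by apply: closed_borel; exact: compact_closed.
(* [compact_bounded] asserts the bound for every number strictly above [M]; [M + 1] is one of these.
   The dominating function is then a multiple of the indicator of [K]. *)
have [M [_ /(_ (M + 1))Mf]] := compact_bounded (image_compact cf cK).
have /Mf {}Mf : M < M + 1 by rewrite ltrDl.
have mf : measurable_fun [set: borel (base mu)] (EFin \o f).
  by apply/measurable_EFinP; exact: continuous_measurable.
have iK : mu.-integrable [set: borel (base mu)] (fun x => (\1_K x)%:E).
  apply/integrableP; split.
    by apply/measurable_EFinP; exact: measurable_indic.
  under eq_integral do rewrite gee0_abs ?lee_fin//.
  by rewrite integral_indic// setIT; exact: radon_compact.
apply: (le_integrable measurableT mf _ (integrableZl measurableT `|M + 1| iK)).
move=> x _ /=; rewrite lee_fin indicE.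
have [/set_mem Kx|/negP nKx] := boolP (x \in K).
  rewrite mulr1 normr_id; apply: le_trans (ler_norm _).
  by apply: (Mf (f x)); exists x.
by rewrite Kf ?normr0 ?mulr0 ?normr0// => Kx; apply: nKx; exact: mem_set.
Qed.

(** * Integrals whose measure and integrand both depend on a parameter *)

Section skew_integral.
Context (R : realType) (X Y Z : topologicalType).
Variable lambda : X -> borel_measure R Y.
Hypothesis lchY : locally_compact_hausdorff Y.
Hypothesis hZ : hausdorff_space Z.
Hypothesis rlambda : forall x, radon (lambda x).
Hypothesis clambda : forall f : Y -> R, compactly_supported f ->
  continuous (fun x => \int[lambda x]_(y in setT) f y).

Let hY := lchY.2.

(** All functions [f (-, z)] vanish off the same compact set [K], the projection of a compact set
    carrying [f]. Changing [x] at fixed [z0] is governed by [clambda]; changing [z] costs at most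
    [d] times the integral of a bump [chi] that is at least 1 on [K], and this integral stays
    bounded for [x] near [x0]. *)
Lemma continuous_parametric_integral (f : Y * Z -> R) : compactly_supported f ->
  continuous (fun xz : X * Z =>
    \int[lambda xz.1]_(y in setT) f (y, xz.2)).
Proof.
move=> csf; have cf := csf.1.
have [L cL Lf] := (compactly_supportedP (hausdorff_prod hY hZ) cf).1 csf.
have cK := image_compact (@continuous_fst Y Z) cL.
set K := fst @` L in cK.
have Kf y z : ~ K y -> f (y, z) = 0.
  by move=> nKy; apply: Lf => Lyz; apply: nKy; exists (y, z).
have cfz z : continuous (fun y => f (y, z)).
  move=> y; apply: (continuous_comp (f := fun y => (y, z))); last exact: cf.
  by apply: cvg_pair; [exact: cvg_id | exact: cvg_cst].
have csfz z : compactly_supported (fun y => f (y, z)).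
  apply/compactly_supportedP => //; exists K => // y; exact: Kf.
have [chi [cschi chi0 chiK]] := compact_bump R lchY cK.
pose int x g := \int[lambda x]_(y in [set: borel (base (lambda x))]) g y.
move=> [x0 z0]; apply/cvgrPdist_lt => e e0.
set B := int x0 chi.
have B0 : 0 <= B by apply: Rintegral_ge0 => y _.
have B10 : 0 < B + 1 by rewrite ltr_wpDl.
(* Near [x0] the integral of [chi] is below [B + 1], so a uniform error [d] on [K] contributes at
   most [e / 2]. *)
pose d := e / 2 / (B + 1).
have d0 : 0 < d by rewrite !divr_gt0.
have nearB : \forall x \near x0, int x chi < B + 1.
  by apply: (cvgr_lt _ (clambda cschi (x := x0))); rewrite ltrDl.
have near0 : \forall x \near x0,
    `|int x0 (fun y => f (y, z0)) - int x (fun y => f (y, z0))| < e / 2.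
  have /cvgrPdist_lt := clambda (csfz z0) (x := x0).
  by apply; rewrite divr_gt0.
(* A tube-lemma argument: compactness of [K] turns continuity at each [(y, z0)] into an estimate
   uniform in [y]. *)
have nearf : \forall z \near z0, forall y, K y -> `|f (y, z0) - f (y, z)| < d.
  pose P z y := `|f (y, z0) - f (y, z)| < d.
  suff H : forall y, K y -> \forall y' \near y & z \near z0, P z y'.
    exact: (compact_near_coveringP K).1 cK Z (nbhs z0) P _ H.
  move=> y Ky.
  have cdf : continuous (fun yz : Y * Z => f (yz.1, z0) - f yz).
    move=> yz; apply: cvgB; last exact: cf.
    apply: (@continuous_comp _ _ _ fst (fun y => f (y, z0))); last exact: cfz.
    exact: continuous_fst.
  have := cdf (y, z0); rewrite /continuous_at /= subrr.
  move=> /cvgr0_norm_lt/(_ d d0).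
  by apply: filterS => -[y' z'].
exists ([set x | int x chi < B + 1 /\
   `|int x0 (fun y => f (y, z0)) - int x (fun y => f (y, z0))| < e / 2],
   [set z | forall y, K y -> `|f (y, z0) - f (y, z)| < d]).
  by split => //; exact: filterI.
move=> [x z] /= [[xB x0z] zf].
(* The intermediate term is the integral of [f (-, z0)] against the measure at [x]. *)
rewrite (le_lt_trans (ler_distD (int x (fun y => f (y, z0))) _ _))//.
rewrite [e]splitr ltr_leD//.
rewrite /int -RintegralB//; try exact: compactly_supported_integrable.
have csd : compactly_supported (fun y => f (y, z0) - f (y, z)).
  apply/compactly_supportedP => //.
    by move=> y; apply: cvgB; exact: cfz.
  by exists K => // y nKy; rewrite !Kf// subrr.
have csn : compactly_supported (fun y => `|f (y, z0) - f (y, z)|).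
  apply/compactly_supportedP => //.
    by move=> y; apply: cvg_norm; exact: csd.1.
  by exists K => // y nKy; rewrite !Kf// subrr normr0.
have csdchi : compactly_supported (fun y => d * chi y).
  have [L' cL' chiL'] := (compactly_supportedP hY cschi.1).1 cschi.
  apply/compactly_supportedP => //.
    by move=> y; apply: cvgM; [exact: cvg_cst | exact: cschi.1].
  by exists L' => // y /chiL' ->; rewrite mulr0.
apply: le_trans (le_normr_Rintegral _ _) _ => //.
  exact: compactly_supported_integrable.
apply: (@le_trans _ _ (int x (fun y => d * chi y))).
  apply: le_Rintegral => //; try exact: compactly_supported_integrable.
  move=> y _; have [Ky|nKy] := pselect (K y); last first.
    by rewrite !Kf// subrr normr0 mulr_ge0// ltW.
  by rewrite (le_trans (ltW (zf y Ky)))// ler_peMr ?chiK// ltW.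
rewrite /int RintegralZl//; last exact: compactly_supported_integrable.
rewrite /d mulrAC ler_pdivrMr// ler_pM2l ?divr_gt0//.
exact: ltW.
Qed.
End skew_integral.

Lemma integral_eq_mod (R : realType) (X : topologicalType)
    (mu : borel_measure R X) (f g : X -> R) (C : set X) :
  continuous f -> continuous g -> closed C -> mu (~` C) = 0%E ->
  (forall x, C x -> f x = g x) ->
  \int[mu]_(x in setT) f x = \int[mu]_(x in setT) g x.
Proof.
move=> cf cg cC C0 fg; congr fine; apply: ae_eq_integral => //.
- by apply/measurable_EFinP; exact: continuous_measurable.
- by apply/measurable_EFinP; exact: continuous_measurable.
exists (~` C); split => //; first exact: borelC (closed_borel cC).
by move=> x /=; apply: contra_not => Cx _ /=; rewrite fg.
Qed.

(** * Skew products *)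

Lemma continuous_mulg (X : topologicalType) (G : topologicalGroupType)
    (f g : X -> G) :
  continuous f -> continuous g -> continuous (fun x => (f x * g x)%g).
Proof.
move=> cf cg.
exact: (comp_continuous (continuous_pair cf cg) (@mulg_continuous G)).
Qed.

Section skew_product_quiver.
Context (R : realType) (Q : quiver R) (G : topologicalGroupType).
Variable kappa : edge Q -> G.
Hypotheses (tQ : topological_quiver Q) (lchG : locally_compact_hausdorff G).
Hypothesis ckappa : continuous kappa.

(** The inclusion of [edge Q] at level [g] has [fst] as a left inverse everywhere, so the
    exceptional null set is empty. An integral over the skew product is one of [f (-, g)] against
    the measure at [v], hence the parametric continuity above applies. *)
Lemma skew_product_topological : topological_quiver (skew_product kappa).
Proof.
have [lchV lchE cr cs os [rad supp cont prop]] := tQ.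
have hE := lchE.2; have hG := lchG.2; have hEG := hausdorff_prod hE hG.
have cfst := @continuous_fst (edge Q) G.
have csnd := @continuous_snd (edge Q) G.
have fstK v (g : G) : sys Q v [set e | (e, g).1 <> e] = 0%E.
  by rewrite (_ : [set _ | _] = set0) ?measure0//; apply/seteqP; split.
split.
- exact: lch_prod.
- exact: lch_prod.
- apply: continuous_pair; first exact: comp_continuous cfst cr.
  by apply: continuous_mulg => //; exact: comp_continuous cfst ckappa.
- by apply: continuous_pair => //; exact: comp_continuous cfst cs.
- exact: open_map_prod_id.
- split.
  + move=> [v g].
    exact: (radon_pushforward hE hEG _ cfst (rad v) (fstK v g)).
  + move=> [v g].
    rewrite (support_pushforward hE hEG _ cfst (fstK v g)) supp.
    apply/seteqP; split=> [_ [e /= <- <-]//|[e h] /= [<- <-]].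
    by exists e.
  + move=> f csf.
    have E vg : \int[sys (skew_product kappa) vg]_(e in setT) f e =
        \int[sys Q vg.1]_(y in setT) f (y, vg.2).
      apply: integral_borel_change csf.1 _ => //.
      exact: pair_continuous.
    rewrite (funext E).
    exact: continuous_parametric_integral.
  + by move=> [v g]; exact: prop.
Qed.

Lemma right_translation_continuous (X : topologicalType) :
  continuous_action (right_translation G X).
Proof.
apply: continuous_pair.
  exact: (comp_continuous (@continuous_fst _ _) (@continuous_fst _ _)).
apply: continuous_mulg; last exact: continuous_snd.
exact: (comp_continuous (@continuous_fst _ _) (@continuous_snd _ _)).
Qed.

Lemma skew_product_action :
  quiver_action (Q := skew_product kappa)
    (right_translation G (vert Q)) (right_translation G (edge Q)).
Proof.
have ctrans := right_translation_continuous.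
have ctransg (X : topologicalType) g :
    continuous (fun x => right_translation G X x g).
  apply: (@comp_continuous _ _ _ (fun x => (x, g)) _ _ (ctrans X)).
  by apply: continuous_pair => x; [exact: cvg_id | exact: cvg_cst].
have htrans (X : topologicalType) g :
    homeomorphism (fun x => right_translation G X x g).
  split; first exact: ctransg.
  exists (fun x => right_translation G X x (g^-1)%g); split.
  - exact: ctransg.
  - by move=> x; rewrite -ractM mulgV ract1.
  - by move=> x; rewrite -ractM mulVg ract1.
split=> [||g]; [exact: ctrans | exact: ctrans |].
split; [|exact: htrans|exact: htrans|].
  split; [exact: ctransg|exact: ctransg| |by []].
  by move=> e /=; rewrite mulgA.
move=> [v h] U mU Us /=; congr (sys Q v _).
(* The slice of [U] at level [h] is compared with the slice of its translate at level [h * g]; right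
   cancellation identifies them. *)
apply/seteqP; split=> [e Ue|e [[e' h'] Ue' [<-]]].
  by exists (e, h).
by move/mulIg => <-.
Qed.

Lemma right_translation_free (X : topologicalType) :
  free_action (right_translation G X).
Proof.
by move=> [x h] g [] /eqP; rewrite -{2}[h]mulg1 => /eqP/mulgI.
Qed.

Lemma right_translation_proper (X : topologicalType) :
  hausdorff_space X -> proper_action (right_translation G X).
Proof.
move=> hX; have cfst Y Z := @continuous_fst Y Z.
have csnd Y Z := @continuous_snd Y Z.
have cact : continuous (fun xhg : X * G * G =>
    (xhg.1, right_translation G X xhg.1 xhg.2)).
  apply: continuous_pair; first exact: cfst.
  exact: right_translation_continuous.
split=> // K cK.
have hXG := hausdorff_prod hX lchG.2.
pose psi (p : (X * G) * (X * G)) := (p.1, ((p.1.2)^-1 * p.2.2)%g).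
have cpsi : continuous psi.
  apply: continuous_pair; first exact: cfst.
  apply: continuous_mulg.
    apply: (comp_continuous _ (@invg_continuous G)).
    exact: comp_continuous (cfst _ _) (csnd _ _).
  exact: comp_continuous (csnd _ _) (csnd _ _).
apply: (subclosed_compact _ (image_compact cpsi cK)).
  have clK := compact_closed (hausdorff_prod hXG hXG) cK.
  by move/continuous_closedP : cact; apply.
move=> [[x h] g] /= Kx; exists ((x, h), (x, (h * g)%g)) => //.
by rewrite /psi /= mulKg.
Qed.

End skew_product_quiver.

(** * Orbit quivers *)

Section slice.
Context (G : topologicalGroupType) (X : topologicalType).
Variables (a : right_action G X) (c : X -> G).
Hypotheses (ca : continuous_action a) (cc : continuous c).
Hypothesis cE : forall x g, c (a x g) = (c x * g)%g.

Definition slice (o : orbit_space a) : X :=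
  a (orbit_repr o) (c (orbit_repr o))^-1%g.

Lemma orbit_map_act (x : X) g : orbit_map a (a x g) = orbit_map a x.
Proof. by apply/esym/orbit_mapP; exists g. Qed.

(** The representative is [a x g] for some [g], and the factor [g] cancels against the one in its
    value under [c]. Thus [slice] does not depend on the choice made by [orbit_repr]. *)
Lemma slice_orbit_map x : slice (orbit_map a x) = a x (c x)^-1%g.
Proof.
rewrite /slice; have /orbit_mapP[g ->] := esym (orbit_reprK (orbit_map a x)).
by rewrite cE invgM -ractM mulgA mulgV mul1g.
Qed.

Lemma sliceK : cancel slice (orbit_map a).
Proof. by move=> o; rewrite orbit_map_act orbit_reprK. Qed.

Lemma slice1 o : c (slice o) = 1%g.
Proof. by rewrite cE mulgV. Qed.

Lemma act_continuous g : continuous (fun x => a x g).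
Proof.
apply: (@comp_continuous _ _ _ (fun x => (x, g)) _ _ ca).
by apply: continuous_pair => x; [exact: cvg_id | exact: cvg_cst].
Qed.

(** By the universal property of the quotient topology it suffices that the composite with the orbit
    map, [x |-> a x (c x)^-1], is continuous. *)
Lemma slice_continuous : continuous slice.
Proof.
apply/quotient_continuous.
rewrite (_ : _ \o _ = (fun x => a x (c x)^-1%g)); last first.
  by apply/funext => x; exact: slice_orbit_map.
apply: (@comp_continuous _ _ _ (fun x => (x, (c x)^-1%g)) _ _ ca).
apply: continuous_pair; first by move=> x; exact: cvg_id.
exact: comp_continuous cc (@invg_continuous G).
Qed.

(** The saturation of [U] is the union of its preimages under all the maps [a - g], each of which is
    open. *)
Lemma orbit_map_open : open_map (orbit_map a).
Proof.
move=> U oU; rewrite /open /= /quotient_open.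
rewrite (_ : _ @^-1` _ = \bigcup_(g in setT) ((fun x => a x g) @^-1` U)).
  apply: bigcup_open => g _; apply: open_comp => // x _.
  exact: act_continuous.
apply/seteqP; split=> [x [y Uy /orbit_mapP[g ygx]]|x [g _ /= Ug]]; last first.
  by exists (a x g) => //; exact: orbit_map_act.
by exists g^-1%g => //=; rewrite ygx -ractM mulgV ract1.
Qed.

(** The slice embeds the orbit space injectively and continuously into [X], which gives the
    Hausdorff property; openness of the orbit map gives local compactness. *)
Lemma orbit_space_lch :
  locally_compact_hausdorff X -> locally_compact_hausdorff (orbit_space a).
Proof.
move=> [lX hX]; have hO : hausdorff_space (orbit_space a).
  exact: hausdorff_injective slice_continuous (can_inj sliceK) hX.
split=> //.
apply: locally_compact_open_image orbit_map_open _ hO lX.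
  exact: orbit_map_continuous.
by move=> o _; exists (slice o) => //; exact: sliceK.
Qed.

Lemma slice_act_continuous :
  continuous (fun og : orbit_space a * G => a (slice og.1) og.2).
Proof.
apply: (@comp_continuous _ _ _ (fun og => (slice og.1, og.2)) _ _ ca).
apply: continuous_pair; last exact: continuous_snd.
exact: comp_continuous (@continuous_fst _ _) slice_continuous.
Qed.

Lemma slice_homeomorphism : homeomorphism (fun x => (orbit_map a x, c x)).
Proof.
split; first by apply: continuous_pair => //; exact: orbit_map_continuous.
exists (fun og => a (slice og.1) og.2); split.
- exact: slice_act_continuous.
- by move=> x; rewrite /= slice_orbit_map -ractM mulVg ract1.
- by move=> [y g] /=; rewrite orbit_map_act sliceK cE slice1 mul1g.
Qed.

End slice.
Arguments slice {G X} a c o.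

(** * The orbit quiver of an action with an equivariant map to the group *)

Section quiver_slice.
Context (R : realType) (F : quiver R) (G : topologicalGroupType).
Variables (a0 : right_action G (vert F)) (a1 : right_action G (edge F)).
Variable c : vert F -> G.
Hypotheses (tF : topological_quiver F) (lchG : locally_compact_hausdorff G).
Hypothesis act : quiver_action a0 a1.
Hypothesis cc : continuous c.
Hypothesis cE : forall v g, c (a0 v g) = (c v * g)%g.

Let O := orbit_quiver a0 a1.
Let q0 := orbit_map a0.
Let q1 := orbit_map a1.
Let d (e : edge F) : G := c (src F e).

Let rE e g : rng F (a1 e g) = a0 (rng F e) g.
Proof. exact: morph_rng (iso_morphism (action_automorphism act g)) e. Qed.

Let sE e g : src F (a1 e g) = a0 (src F e) g.
Proof. exact: morph_src (iso_morphism (action_automorphism act g)) e. Qed.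

Let dE e g : d (a1 e g) = (d e * g)%g.
Proof. by rewrite /d sE cE. Qed.

Let cd : continuous d.
Proof. exact: comp_continuous (src_continuous tF) cc. Qed.

Let ca0 := action_vert_continuous act.
Let ca1 := action_edge_continuous act.

Let rad := system_radon (sys_full tF).
Let supp := system_support (sys_full tF).

Lemma rng_orbit e : rng O (q1 e) = q0 (rng F e).
Proof.
apply/orbit_mapP; have /orbit_mapP[g eg] := orbit_reprK (q1 e).
by exists g; rewrite -rE -eg.
Qed.

Lemma src_orbit e : src O (q1 e) = q0 (src F e).
Proof.
apply/orbit_mapP; have /orbit_mapP[g eg] := orbit_reprK (q1 e).
by exists g; rewrite -sE -eg.
Qed.

Let closed_fiber v : closed (src F @^-1` [set v]).
Proof.
apply: closed_equalizer (vert_lch tF).2 (src_continuous tF) _.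
by move=> e; exact: cvg_cst.
Qed.

Let fiber_null v : sys F v (~` (src F @^-1` [set v])) = 0%E.
Proof.
have := radon_support_null (edge_lch tF).2 (rad v) (@closed_fiber v); apply.
by rewrite supp.
Qed.

Let sys_act v g B : borel_set B ->
  sys F (a0 v g) (q1 @^-1` B) = sys F v (q1 @^-1` B).
Proof.
move=> mB; have mqB : borel_set (q1 @^-1` B).
  by apply: preimage_borel mB; exact: orbit_map_continuous.
have mfib w := closed_borel (@closed_fiber w).
have fibE w : sys F w (q1 @^-1` B) =
    sys F w (q1 @^-1` B `&` src F @^-1` [set w]).
  apply: (eq_borel_measure_mod mqB _ (mfib w) (fiber_null w)).
    exact: borelI.
  by rewrite -setIA setIid.
rewrite fibE [RHS]fibE [RHS](iso_sys (action_automorphism act g)).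
- congr (sys F _ _); apply/seteqP; split => [e [/= Be se]|_ [e [/= Be se] <-]].
    exists (a1 e g^-1%g); last by rewrite -ractM mulVg ract1.
    split=> /=; first by rewrite /q1 orbit_map_act.
    by rewrite sE se -ractM mulgV ract1.
  by split=> /=; [rewrite /q1 orbit_map_act | rewrite sE se].
- exact: borelI.
- exact: subIsetr.
Qed.

Let sys_orbit v B : borel_set B -> sys O (q0 v) B = sys F v (q1 @^-1` B).
Proof.
move=> mB.
rewrite -[LHS]/(sys F (orbit_repr (q0 v)) (q1 @^-1` B)).
have /orbit_mapP[g vg] := orbit_reprK (q0 v).
by rewrite [in RHS]vg sys_act.
Qed.

Lemma orbit_quiver_topological : topological_quiver O.
Proof.
have [lchV lchE cr cs os [_ _ cont prop]] := tF.
have lchO1 := orbit_space_lch ca1 cd dE lchE.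
have cq0 := @orbit_map_continuous G _ a0.
have cq1 := @orbit_map_continuous G _ a1.
have csl0 := slice_continuous ca0 cc cE.
have csl1 := slice_continuous ca1 cd dE.
(* The choice of [orbit_repr] need not be continuous; rewriting through the slice exhibits range and
   source as composites of continuous maps. *)
have rO : rng O = fun o => q0 (rng F (slice a1 d o)).
  by apply/funext => o; rewrite -rng_orbit /q1 sliceK.
have sO : src O = fun o => q0 (src F (slice a1 d o)).
  by apply/funext => o; rewrite -src_orbit /q1 sliceK.
split => //.
- exact: orbit_space_lch ca0 cc cE lchV.
- by rewrite rO; apply: comp_continuous cq0; exact: comp_continuous csl1 cr.
- by rewrite sO; apply: comp_continuous cq0; exact: comp_continuous csl1 cs.
- move=> U oU.
  rewrite (_ : _ @` _ = q0 @` (src F @` (q1 @^-1` U))).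
    apply: orbit_map_open ca0 _ _; apply: os.
    by apply: open_comp => // x _; exact: cq1.
  apply/seteqP; split=> [_ [ o Uo <-]|_ [_ [e Ue <-] <-]]; last first.
    by exists (q1 e) => //; exact: src_orbit.
  exists (src F (slice a1 d o)); last by rewrite -src_orbit /q1 sliceK.
  by exists (slice a1 d o) => //; rewrite /= /q1 sliceK.
have cs1g g : continuous (fun o => a1 (slice a1 d o) g).
  exact: comp_continuous csl1 (act_continuous ca1 (g := g)).
(* On the fibre over [v = orbit_repr o] one has [d e = c v], so [e] is recovered from its orbit by
   moving the slice by [c v]. This is the continuous left inverse of the orbit map needed for
   push-forwards. *)
have nullE (o : vert O) : sys F (orbit_repr o)
    [set e | a1 (slice a1 d (orbit_map a1 e)) (c (orbit_repr o)) <> e] = 0%E.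
  apply/eqP; rewrite -measure_le0 -(fiber_null (orbit_repr o)).
  apply: le_borel_measure.
  - apply: open_borel; apply: closed_openC.
    apply: closed_equalizer lchE.2 _ _; last by move=> e; exact: cvg_id.
    exact: comp_continuous cq1 (cs1g _).
  - exact: borelC (closed_borel (@closed_fiber _)).
  - move=> e /= ne se; apply: ne.
    by rewrite (slice_orbit_map dE) -ractM /d se mulVg ract1.
split.
- move=> o.
  exact: (radon_pushforward lchE.2 lchO1.2 _ (cs1g _) (rad _) (nullE o)).
- move=> o.
  rewrite (support_pushforward lchE.2 lchO1.2 _ (cs1g _) (nullE o)) supp.
  apply/seteqP; split=> [_ [e /= se <-]|o' /= so'].
    by rewrite [LHS]src_orbit se /q0 orbit_reprK.
  (* Some edge in the orbit [o'] is translated into the fibre over the chosen representative. *)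
  pose e := slice a1 d o'; have qe : q1 e = o' := sliceK d o'.
  have /orbit_mapP[g sg] : q0 (src F e) = q0 (orbit_repr o).
    by rewrite -src_orbit qe [LHS]so' /q0 orbit_reprK.
  by exists (a1 e g); [rewrite /= sE sg | rewrite orbit_map_act].
- move=> f csf; have cf := csf.1.
  have [K cK Kf] := (compactly_supportedP lchO1.2 cf).1 csf.
  have [chi [cschi chi0 chi1]] := point_bump R 1%g lchG.
  have [L cL Lchi] := (compactly_supportedP lchG.2 cschi.1).1 cschi.
  (* The pull-back of [f] is constant along orbits, so it is cut off in the group direction; [h]
     then vanishes off the image of the compact set [K]*[L] under the slice coordinates. *)
  pose h e := f (q1 e) * chi (d e).
  have cfq : continuous (fun e => f (q1 e)) by exact: comp_continuous cq1 cf.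
  have ch : continuous h.
    move=> e; apply: cvgM; first exact: cfq.
    exact: (comp_continuous cd cschi.1).
  have csh : compactly_supported h.
    apply/(compactly_supportedP lchE.2 ch).
    exists ((fun og => a1 (slice a1 d og.1) og.2) @` (K `*` L)).
      apply: image_compact (compact_setX cK cL).
      exact: slice_act_continuous.
    move=> e ne; rewrite /h.
    have [Kq|/Kf ->] := pselect (K (q1 e)); last by rewrite mul0r.
    have [Ld|/Lchi ->] := pselect (L (d e)); last by rewrite mulr0.
    exfalso; apply: ne; exists (q1 e, d e) => //=.
    by rewrite (slice_orbit_map dE) -ractM mulVg ract1.
  (* Evaluating at [slice a0 c o] instead of [orbit_repr o] makes the measure depend continuously on
     [o]. On that fibre [d] is 1, where [chi] equals 1, so the cut-off changes nothing. *)
  have E o : \int[sys O o]_(e in setT) f e =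
      \int[sys F (slice a0 c o)]_(e in setT) h e.
    transitivity (\int[sys F (slice a0 c o)]_(e in setT) f (q1 e)).
      apply: integral_borel_change => // U mU.
      by rewrite -sys_orbit// /q0 sliceK.
    apply: integral_eq_mod cfq ch (@closed_fiber _) (fiber_null _) _ => e /= se.
    by rewrite /h /d se slice1// chi1 mulr1.
  rewrite (funext E).
  exact: (comp_continuous csl0 (cont _ csh)).
- by move=> o; exact: prop.
Qed.

Definition orbit_cocycle (o : edge O) : G := c (rng F (slice a1 d o)).

Lemma orbit_cocycle_continuous : continuous orbit_cocycle.
Proof.
apply: comp_continuous cc; apply: comp_continuous (rng_continuous tF).
exact: slice_continuous ca1 cd dE.
Qed.

Lemma orbit_quiver_skew_product : isomorphic F (skew_product orbit_cocycle).
Proof.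
exists (fun v => (q0 v, c v)), (fun e => (q1 e, d e)).
have h0 := slice_homeomorphism ca0 cc cE.
have h1 := slice_homeomorphism ca1 cd dE.
split => //.
  split; [exact: h0.1 | exact: h1.1 | |].
  - move=> e; congr pair; first exact: rng_orbit.
    (* The slice moves [e] by the inverse of [d e], which the second coordinate [d e] in the skew
       product undoes, leaving [c] of the range of [e]. *)
    rewrite /orbit_cocycle /= /q1 (slice_orbit_map dE) rE cE.
    by rewrite -mulgA mulVg mulg1.
  - by move=> e; congr pair; exact: src_orbit.
move=> v U mU Us.
pose B := (fun o => a1 (slice a1 d o) (c v)) @^-1` U.
have cs1v : continuous (fun o => a1 (slice a1 d o) (c v)).
  have csl := slice_continuous ca1 cd dE.
  exact: comp_continuous csl (act_continuous ca1 (g := c v)).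
have mB : borel_set B by exact: preimage_borel.
have sliceE e : d e = c v -> a1 (slice a1 d (q1 e)) (c v) = e.
  by move=> de; rewrite (slice_orbit_map dE) -ractM de mulVg ract1.
transitivity (sys O (q0 v) B); last first.
  congr (sys O (q0 v) _); apply/seteqP; split=> [p Bp|_ [e Ue [<- de]]].
    exists (a1 (slice a1 d p) (c v)) => //; congr pair.
      by rewrite /q1 orbit_map_act sliceK.
    by rewrite dE (slice1 dE) mul1g.
  by rewrite /B /= sliceE.
rewrite sys_orbit//; have cq1 := @orbit_map_continuous G _ a1.
have mfib := closed_borel (@closed_fiber v).
apply: (eq_borel_measure_mod mU _ mfib (fiber_null v)).
  exact: preimage_borel.
by apply/seteqP; split=> e [/= Ue se]; split => //;
  move: Ue; rewrite /B /= sliceE// /d se.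
Qed.

End quiver_slice.

(** * The orbit quiver of a skew product *)

Section skew_product_orbits.
Context (R : realType) (Q : quiver R) (G : topologicalGroupType).
Variable kappa : edge Q -> G.
Hypotheses (tQ : topological_quiver Q) (lchG : locally_compact_hausdorff G).
Hypothesis ckappa : continuous kappa.

Let S := skew_product kappa.
Let a0 : right_action G (vert S) := right_translation G (vert Q).
Let a1 : right_action G (edge S) := right_translation G (edge Q).

Lemma skew_product_orbits_topological : topological_quiver (orbit_quiver a0 a1).
Proof.
apply: (@orbit_quiver_topological _ _ _ a0 a1 snd) => //.
- exact: skew_product_topological.
- exact: skew_product_action.
- exact: continuous_snd.
Qed.

Lemma orbit_repr_fst (X : topologicalType) (x : X) (h : G) :
  (orbit_repr (orbit_map (right_translation G X) (x, h))).1 = x.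
Proof.
set o := orbit_map _ _.
by have /orbit_mapP[g [<- _]] : orbit_map _ (orbit_repr o) = o := orbit_reprK o.
Qed.

Lemma right_translation_orbits_homeomorphism (X : topologicalType) :
  homeomorphism (fun o : orbit_space (right_translation G X) =>
    (orbit_repr o).1).
Proof.
split.
  (* Translation fixes the first coordinate, so [(orbit_repr o).1] is by computation the first
     coordinate of the slice for [snd], which is continuous. *)
  have := slice_continuous (@right_translation_continuous G X)
    (@continuous_snd X G) (fun _ _ => erefl).
  move=> csl; exact: (comp_continuous csl (@continuous_fst X G)).
exists (fun x => orbit_map (right_translation G X) (x, 1%g)); split.
- apply: (comp_continuous _ (@orbit_map_continuous _ _ _)).
  by apply: continuous_pair => x; [exact: cvg_id | exact: cvg_cst].
- move=> o; rewrite -[in RHS](orbit_reprK o); apply/orbit_mapP.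
  by case: (orbit_repr o) => x h; exists h; rewrite /= mul1g.
- by move=> x; rewrite orbit_repr_fst.
Qed.

Lemma skew_product_orbits_isomorphic : isomorphic (orbit_quiver a0 a1) Q.
Proof.
have h0 := right_translation_orbits_homeomorphism (vert Q).
have h1 := right_translation_orbits_homeomorphism (edge Q).
exists (fun o => (orbit_repr o).1), (fun o => (orbit_repr o).1); split => //.
  split; [exact: h0.1 | exact: h1.1 | |].
  - by move=> o; rewrite [in RHS]/= orbit_repr_fst.
  - by move=> o; rewrite [in RHS]/= orbit_repr_fst.
move=> o U mU Us; congr (sys Q _ _).
(* Both sides use the measure at [(orbit_repr o).1]. An orbit [p] is also the orbit of its first
   coordinate paired with [(orbit_repr o).2], since translations act transitively on the second
   coordinate. *)
apply/seteqP; split=> [e Ue|_ [p Up <-]].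
  by exists (orbit_map a1 (e, (orbit_repr o).2)); rewrite ?orbit_repr_fst.
move: Up; rewrite /preimage /= -{1}(orbit_reprK p).
congr U; apply/orbit_mapP; exists ((orbit_repr p).2^-1 * (orbit_repr o).2)%g.
by rewrite /= mulVKg.
Qed.

End skew_product_orbits.

Local Close Scope ring_scope.

Theorem theorem3p8 (R : realType) :
  (forall (Q : quiver R) (G : topologicalGroupType) (kappa : edge Q -> G),
     topological_quiver Q -> locally_compact_hausdorff G -> continuous kappa ->
     let S := skew_product kappa in
     let a0 : right_action G (vert S) := right_translation G (vert Q) in
     let a1 : right_action G (edge S) := right_translation G (edge Q) in
     [/\ topological_quiver S,
         quiver_action a0 a1,
         free_quiver_action a0 /\ proper_quiver_action a0,
         topological_quiver (orbit_quiver a0 a1)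
       & isomorphic (orbit_quiver a0 a1) Q])
  /\
  (forall (F : quiver R) (G : topologicalGroupType)
          (a0 : right_action G (vert F)) (a1 : right_action G (edge F)),
     topological_quiver F -> locally_compact_hausdorff G ->
     quiver_action a0 a1 -> free_quiver_action a0 -> proper_quiver_action a0 ->
     trivial_orbit_map a0 ->
     exists (Q : quiver R) (kappa : edge Q -> G),
       [/\ topological_quiver Q, continuous kappa
         & isomorphic F (skew_product kappa)]).
Proof.
split=> [Q G kappa tQ lchG ck S a0 a1|F G a0 a1 tF lchG act _ _].
  split.
  - exact: skew_product_topological.
  - exact: skew_product_action.
  - split; first exact: right_translation_free.
    by apply: right_translation_proper => //; exact: (vert_lch tQ).2.
  - exact: skew_product_orbits_topological.
  - exact: skew_product_orbits_isomorphic.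
move=> [phi [[cphi _] _ phiE]].
have cc : continuous (fun v => (phi v).2).
  exact: comp_continuous cphi (@continuous_snd _ _).
have cE v g : (phi (a0 v g)).2 = ((phi v).2 * g)%g by rewrite phiE.
exists (orbit_quiver a0 a1), (orbit_cocycle (fun v => (phi v).2)); split.
- exact: (orbit_quiver_topological tF lchG act cc cE).
- exact: (orbit_cocycle_continuous tF act cc cE).
- exact: (orbit_quiver_skew_product tF act cc cE).
Qed.
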